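(* Consider the following matrices in $M(6,1)$ of rank $3$ (rows listed top to bottom): $Ia$: $(1,1,0,0,1,0),(1,1,0,1,0,0),(0,0,1,1,1,0),(0,0,1,1,0,1),(0,0,1,0,1,1),(1,1,0,0,0,1)$; $Ib$: $(1,0,0,0,1,1),(1,1,1,0,0,0),(0,1,1,1,0,0),(0,0,1,1,0,1),(0,1,0,1,1,0),(1,0,0,0,1,1)$; $II$: $(1,1,0,0,0,1),(1,1,0,0,1,0),(1,0,1,1,0,0),(0,0,1,1,1,0),(0,0,0,1,1,1),(0,1,1,0,0,1)$; $III$: $(1,1,1,0,0,0),(1,1,0,0,0,1),(0,0,1,1,1,0),(0,0,0,1,1,1),(0,0,1,1,1,0),(1,1,0,0,0,1)$; $IV$: $(1,1,0,0,0,1),(1,1,1,0,0,0),(0,1,1,1,0,0),(0,0,1,1,1,0),(0,0,0,1,1,1),(1,0,0,0,1,1)$; $V$: $(1,1,1,0,0,0),(1,1,1,0,0,0),(1,1,1,0,0,0),(0,0,0,1,1,1),(0,0,0,1,1,1),(0,0,0,1,1,1)$; $VI$: $(1,1,0,0,1,0),(1,1,0,0,0,1),(1,0,1,1,0,0),(0,1,1,1,0,0),(0,0,1,0,1,1),(0,0,0,1,1,1)$. Every semi-magic hypergraph of rank $3$ on $6$ vertices is equivalent to exactly one of the seven hypergraphs whose incidence matrices are $Ia,Ib,II,III,IV,V,VI$. Consequently the $G$-orbits of rank-$3$ elements of $M(6,1)$ are exactly six: the orbit containing both $Ia$ and $Ib$, and the orbits of $II,III,IV,V,VI$. Only for the orbit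 $\{Ia,Ib\}$ are the two hypergraphs of the associated hypergraph pair $(H,H^* )$ inequivalent (one in class $Ia$, the other in class $Ib$); for each of $II,\dots,VI$, $H$ and $H^*$ are equivalent. These classes are distinguished by the following features: $Ia$: one pair of repeated triangles, disjoint from a three-cycle of double edges; $Ib$: three double edges at a vertex, disjoint from a unique triple edge; $II$: two pairs of adjacent double edges; $III$: two pairs of repeated triangles, each containing a triple edge; $IV$: a six-cycle of double edges; $V$: a disjoint pair of triangle triplets; $VI$: a triplet of disjoint double edges.
   Context: $M(6,1)$ is the set of $6\times 6$ $(0,1)$-matrices with all row and column sums equal to a common value (the rank). $G$ is the group of transformations $M\mapsto P_\sigma MP_\tau^{-1}$ and $M\mapsto P_\sigma M^TP_\tau^{-1}$ ($\sigma,\tau\in S_6$, $P_\sigma$ the permutation matrix). A hypergraph on vertex set $\{1,\dots,6\}$ with hyperedges $e_1,\dots,e_m$ (repetitions allowed) has incidence matrix with $(i,j)$ entry $1$ iff $i\in e_j$; it is semi-magic of rank $3$ if each hyperedge has $3$ vertices and each vertex lies in $3$ hyperedges (incidence matrix in $M(6,1)$ of rank $3$). For $M\in M(6,1)$, $H$ is the hypergraph with incidence matrix $M$ and $H^*$ the one with incidence matrix $M^T$. Two hypergraphs are equivalent if a bijection of the vertex set induces a bijection between their hyperedges (as multisets). In the feature descriptions, hyperedges of size $3$ are viewed as triangles on the vertices, a double (resp. triple) edge is a pair of vertices lying together in exactly two (resp. three) hyperedges, and repeated triangles are hyperedges occurring more than once. *)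

(* Defs.v *)
From mathcomp Require Import all_boot all_order all_algebra all_fingroup.

Set Implicit Arguments.
Unset Strict Implicit.
Unset Printing Implicit Defensive.

Import GRing.Theory GroupScope.

Local Open Scope ring_scope.

(* A (0,1)-matrix is a matrix over [bool], which MathComp sees as the field
   with two elements.  Multiplication by a permutation matrix only rearranges
   rows or columns, so the choice of coefficient ring is immaterial in [G];
   row and column sums are always computed in [nat]. *)
Notation bmx := 'M[bool]_6.

(* the rank-[r] elements of M(6,1) *)
Definition of_rank (r : nat) : {set bmx} :=
  [set M : bmx | [forall i, (\sum_j nat_of_bool (M i j))%N == r]
              && [forall j, (\sum_i nat_of_bool (M i j))%N == r]].

Definition shuffle (s t : 'S_6) (M : bmx) : bmx :=
  perm_mx s *m M *m invmx (perm_mx t).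

Lemma invmx_perm (s : 'S_6) : invmx (perm_mx s) = perm_mx s^-1 :> bmx.
Proof. by rewrite perm_mxV. Qed.

Lemma shuffleM (s t u v : 'S_6) (M : bmx) :
  shuffle u v (shuffle s t M) = shuffle (u * s)%g (v * t)%g M.
Proof. by rewrite /shuffle !invmx_perm invMg !perm_mxM !mulmxA. Qed.

Lemma shuffle1 (M : bmx) : shuffle 1 1 M = M.
Proof. by rewrite /shuffle !invmx_perm invg1 perm_mx1 mul1mx mulmx1. Qed.

Lemma shuffle_tr (s t : 'S_6) (M : bmx) : (shuffle s t M)^T = shuffle t s M^T.
Proof.
by rewrite /shuffle !invmx_perm !trmx_mul !tr_perm_mx invgK mulmxA.
Qed.

Lemma shuffle_inj (s t : 'S_6) : injective (shuffle s t).
Proof.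
by apply: (can_inj (g := shuffle s^-1 t^-1)) => M; rewrite shuffleM !mulVg shuffle1.
Qed.

Lemma shuffleT_inj (s t : 'S_6) : injective (fun M => shuffle s t M^T).
Proof. by move=> M N /shuffle_inj/trmx_inj. Qed.

Definition G : {set {perm bmx}} :=
  [set perm (@shuffle_inj s t) | s : 'S_6, t : 'S_6]
    :|: [set perm (@shuffleT_inj s t) | s : 'S_6, t : 'S_6].

Lemma GP (g : {perm bmx}) :
  reflect (exists s t : 'S_6,
             (forall M, g M = shuffle s t M) \/
             (forall M, g M = shuffle s t M^T))
          (g \in G).
Proof.
apply: (iffP setUP) => [[] /imset2P[s t _ _ ->]|[s [t []]] gE].
- by exists s, t; left=> M; rewrite permE.
- by exists s, t; right=> M; rewrite permE.
- by left; apply/imset2P; exists s t => //; apply/permP=> M; rewrite permE gE.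
- by right; apply/imset2P; exists s t => //; apply/permP=> M; rewrite permE gE.
Qed.

Lemma group_set_G : group_set G.
Proof.
apply/group_setP; split.
  by apply/GP; exists 1%g, 1%g; left=> M; rewrite perm1 shuffle1.
move=> g h /GP[s [t gE]] /GP[u [v hE]]; apply/GP.
case: gE => gE; case: hE => hE.
- by exists (u * s)%g, (v * t)%g; left=> M; rewrite permM gE hE shuffleM.
- by exists (u * t)%g, (v * s)%g; right=> M;
    rewrite permM gE hE shuffle_tr shuffleM.
- by exists (u * s)%g, (v * t)%g; right=> M; rewrite permM gE hE shuffleM.
- by exists (u * t)%g, (v * s)%g; left=> M;
    rewrite permM gE hE shuffle_tr trmxK shuffleM.
Qed.

Canonical G_group := Group group_set_G.

Definition G_orbit (M : bmx) : {set bmx} := orbit 'P G M.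

Definition hypergraph (m : nat) := m.-tuple {set 'I_6}.

Definition incidence (m : nat) (H : hypergraph m) : 'M[bool]_(6, m) :=
  \matrix_(i, j) (i \in tnth H j).

Definition hypergraph_of (m : nat) (M : 'M[bool]_(6, m)) : hypergraph m :=
  [tuple [set i | M i j] | j < m].

Lemma hypergraph_ofK (m : nat) (M : 'M[bool]_(6, m)) :
  incidence (hypergraph_of M) = M.
Proof. by apply/matrixP=> i j; rewrite mxE tnth_mktuple inE. Qed.

Lemma incidenceK (m : nat) (H : hypergraph m) :
  hypergraph_of (incidence H) = H.
Proof.
apply: eq_from_tnth => j; rewrite tnth_mktuple.
by apply/setP=> i; rewrite inE mxE.
Qed.

Definition semi_magic (r m : nat) (H : hypergraph m) : Prop :=
  (forall e, e \in H -> #|e| = r) /\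
  (forall i : 'I_6, count (fun e : {set 'I_6} => i \in e) H = r).

Definition hequiv (m n : nat) (H : hypergraph m) (K : hypergraph n) : Prop :=
  exists p : 'S_6, perm_eq [seq p @: e | e : {set 'I_6} <- H] K.

Inductive label := Ia | Ib | II | III | IV | V | VI.

Definition rows (c : label) : seq (seq nat) :=
  match c with
  | Ia => [:: [:: 1;1;0;0;1;0]; [:: 1;1;0;1;0;0]; [:: 0;0;1;1;1;0];
              [:: 0;0;1;1;0;1]; [:: 0;0;1;0;1;1]; [:: 1;1;0;0;0;1]]
  | Ib => [:: [:: 1;0;0;0;1;1]; [:: 1;1;1;0;0;0]; [:: 0;1;1;1;0;0];
              [:: 0;0;1;1;0;1]; [:: 0;1;0;1;1;0]; [:: 1;0;0;0;1;1]]
  | II => [:: [:: 1;1;0;0;0;1]; [:: 1;1;0;0;1;0]; [:: 1;0;1;1;0;0];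
              [:: 0;0;1;1;1;0]; [:: 0;0;0;1;1;1]; [:: 0;1;1;0;0;1]]
  | III => [:: [:: 1;1;1;0;0;0]; [:: 1;1;0;0;0;1]; [:: 0;0;1;1;1;0];
               [:: 0;0;0;1;1;1]; [:: 0;0;1;1;1;0]; [:: 1;1;0;0;0;1]]
  | IV => [:: [:: 1;1;0;0;0;1]; [:: 1;1;1;0;0;0]; [:: 0;1;1;1;0;0];
              [:: 0;0;1;1;1;0]; [:: 0;0;0;1;1;1]; [:: 1;0;0;0;1;1]]
  | V => [:: [:: 1;1;1;0;0;0]; [:: 1;1;1;0;0;0]; [:: 1;1;1;0;0;0];
             [:: 0;0;0;1;1;1]; [:: 0;0;0;1;1;1]; [:: 0;0;0;1;1;1]]
  | VI => [:: [:: 1;1;0;0;1;0]; [:: 1;1;0;0;0;1]; [:: 1;0;1;1;0;0];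
              [:: 0;1;1;1;0;0]; [:: 0;0;1;0;1;1]; [:: 0;0;0;1;1;1]]
  end%N.

Definition mx_of (c : label) : bmx :=
  \matrix_(i, j) (nth 0 (nth [::] (rows c) i) j == 1)%N.

Definition class_hypergraph (c : label) : hypergraph 6 :=
  hypergraph_of (mx_of c).

Definition repeated_triangles (m : nat) (H : hypergraph m) :
    {set {set 'I_6}} :=
  [set t : {set 'I_6} | (1 < count_mem t H)%N].

Definition multi_edges (k m : nat) (H : hypergraph m) : {set {set 'I_6}} :=
  [set p : {set 'I_6} |
    (#|p| == 2%N) && (count (fun e : {set 'I_6} => p \subset e) H == k)].

Definition double_edges (m : nat) (H : hypergraph m) := multi_edges 2 H.

Definition triple_edges (m : nat) (H : hypergraph m) := multi_edges 3 H.

(* A pair contained in a repeated triangle is automatically at least a double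
   edge; these are the pairs of [A] that do not arise in this way. *)
Definition outside_repeated (m : nat) (H : hypergraph m)
    (A : {set {set 'I_6}}) : {set {set 'I_6}} :=
  [set p in A | [forall t in repeated_triangles H, ~~ (p \subset t)]].

(* Each description is complete: every repeated triangle, and every double or
   triple edge that is not contained in a repeated triangle, is one of those
   mentioned.  Otherwise III, whose double edges are also two pairs of adjacent
   ones, would have the feature of II, and IV would have that of VI. *)
Definition feature (c : label) (m : nat) (H : hypergraph m) : Prop :=
  match c with
  | Ia => exists (t : {set 'I_6}) (x y z : 'I_6),
      [/\ repeated_triangles H = [set t] /\ count_mem t H = 2%N,
          uniq [:: x; y; z],
          [disjoint t & [set x; y; z]],
          outside_repeated H (double_edges H)
            = [set [set x; y]; [set y; z]; [set z; x]]
        & triple_edges H = set0]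
  | Ib => exists (p : {set 'I_6}) (v x y z : 'I_6),
      [/\ repeated_triangles H = set0,
          triple_edges H = [set p],
          uniq [:: v; x; y; z],
          double_edges H = [set [set v; x]; [set v; y]; [set v; z]]
        & [disjoint p & [set v; x; y; z]]]
  | II => exists v x y w x' y' : 'I_6,
      [/\ repeated_triangles H = set0,
          triple_edges H = set0,
          uniq [:: v; x; y; w; x'; y']
        & double_edges H
            = [set [set v; x]; [set v; y]; [set w; x']; [set w; y']]]
  | III => exists t t' p p' : {set 'I_6},
      [/\ repeated_triangles H = [set t; t'] /\ t != t',
          count_mem t H = 2%N /\ count_mem t' H = 2%N,
          p \subset t /\ p' \subset t',
          triple_edges H = [set p; p'] /\ p != p'
        & outside_repeated H (double_edges H) = set0]
  | IV => exists u v w x y z : 'I_6,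
      [/\ repeated_triangles H = set0,
          triple_edges H = set0,
          uniq [:: u; v; w; x; y; z]
        & double_edges H
            = [set [set u; v]; [set v; w]; [set w; x];
                   [set x; y]; [set y; z]; [set z; u]]]
  | V => exists t t' : {set 'I_6},
      [/\ repeated_triangles H = [set t; t'] /\ [disjoint t & t'],
          count_mem t H = 3%N /\ count_mem t' H = 3%N,
          outside_repeated H (triple_edges H) = set0
        & outside_repeated H (double_edges H) = set0]
  | VI => exists u v w x y z : 'I_6,
      [/\ repeated_triangles H = set0,
          triple_edges H = set0,
          uniq [:: u; v; w; x; y; z]
        & double_edges H = [set [set u; v]; [set w; x]; [set y; z]]]
  end.

(* Main.v *)
Require Import Defs.
From mathcomp Require Import all_boot all_order all_algebra all_fingroup.

Set Implicit Arguments.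
Unset Strict Implicit.
Unset Printing Implicit Defensive.

(* A semi-magic hypergraph of rank 3 is a multiset of triples in which every
   vertex has degree 3; there are only 550 of them, and for each one a
   relabelling onto one of the seven classes is found by computation.
   The seven features are invariant under equivalence, each holds for its own
   class, and the numbers of repeated triangles, triple edges and double edges,
   together with the multiplicity of the repeated triangles, show that it holds
   for no other class.  So the features separate the classes and characterise
   them.  Finally M and N are in the same orbit iff the hypergraph of N is
   equivalent to that of M or of M^T, and transposition fixes each class up to
   equivalence, except that it exchanges Ia and Ib. *)

(** * Sets of vertices as lists of booleans *)

(** Membership vectors in vertex order. All exhaustive computations run on these lists instead of on
    finite sets. *)
Definition bits (A : {set 'I_6}) : bitseq := [seq i \in A | i <- enum 'I_6].

Definition of_bits (b : bitseq) : {set 'I_6} := [set i : 'I_6 | nth false b i].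

Lemma size_bits A : size (bits A) = 6.
Proof. by rewrite size_map size_enum_ord. Qed.

Lemma nth_bits A (i : 'I_6) : nth false (bits A) i = (i \in A).
Proof. by rewrite (nth_map ord0) ?size_enum_ord // nth_ord_enum. Qed.

Lemma bitsK : cancel bits of_bits.
Proof. by move=> A; apply/setP=> i; rewrite inE nth_bits. Qed.

Lemma of_bitsK b : size b = 6 -> bits (of_bits b) = b.
Proof.
move=> b6; apply: (@eq_from_nth _ false) => [|i]; rewrite size_bits ?b6 // => i6.
by rewrite -[i]/(nat_of_ord (Ordinal i6)) nth_bits inE.
Qed.

Lemma bits_inj : injective bits.
Proof. exact: can_inj bitsK. Qed.

Lemma card_bits (A : {set 'I_6}) : #|A| = count id (bits A).
Proof. by rewrite cardE /enum_mem size_filter count_map enumT. Qed.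

Lemma count_mem_bits A (s : seq {set 'I_6}) :
  count_mem (bits A) (map bits s) = count_mem A s.
Proof.
rewrite count_map; apply: eq_count => B /=.
by rewrite inj_eq //; exact: bits_inj.
Qed.

Definition masks : seq bitseq :=
  iter 6 (fun s => [seq true :: b | b <- s] ++ [seq false :: b | b <- s])
    [:: [::]].

Lemma mem_masks b : (b \in masks) = (size b == 6).
Proof.
rewrite /masks; elim: 6 b => [|n IHn] [|x b] //=; rewrite mem_cat.
- by apply/orP=> -[] /mapP[].
- rewrite eqSS -IHn; apply/orP/idP => [[] /mapP[b' ? [_ ->]] //|bn].
  by case: x; [left|right]; apply/mapP; exists b.
Qed.

Definition subb (a b : bitseq) : bool :=
  all (fun k => nth false a k ==> nth false b k) (iota 0 6).

Lemma subset_bits (A B : {set 'I_6}) : (A \subset B) = subb (bits A) (bits B).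
Proof.
apply/subsetP/allP => sAB i; first rewrite mem_iota => /andP[_ i6].
  rewrite -[i]/(nat_of_ord (Ordinal i6)) !nth_bits; exact/implyP/sAB.
by have:= sAB i; rewrite !nth_bits mem_iota ltn_ord => /(_ isT)/implyP.
Qed.

Definition repb (L : seq bitseq) : seq bitseq :=
  [seq b <- masks | 1 < count_mem b L].

Definition multib (k : nat) (L : seq bitseq) : seq bitseq :=
  [seq b <- masks | (count id b == 2) && (count (subb b) L == k)].

Definition outb (L A : seq bitseq) : seq bitseq :=
  [seq b <- A | all (fun t => ~~ subb b t) (repb L)].

Lemma mem_map_of_bits A (s : seq bitseq) :
  all [pred b | size b == 6] s -> (A \in map of_bits s) = (bits A \in s).
Proof.
move=> /allP s6; apply/mapP/idP => [[b bs ->]|As]; last first.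
  by exists (bits A); rewrite ?bitsK.
by rewrite of_bitsK //; apply/eqP/s6.
Qed.

Lemma filter_masks6 (a : pred bitseq) : all [pred b | size b == 6] (filter a masks).
Proof. by apply/allP=> b; rewrite mem_filter mem_masks => /andP[]. Qed.

Lemma repeated_triangles_bits m (H : hypergraph m) :
  repeated_triangles H = [set:: map of_bits (repb (map bits H))].
Proof.
apply/setP=> A; rewrite !inE mem_map_of_bits ?filter_masks6 //.
by rewrite mem_filter mem_masks size_bits eqxx andbT count_mem_bits.
Qed.

Lemma multi_edges_bits k m (H : hypergraph m) :
  multi_edges k H = [set:: map of_bits (multib k (map bits H))].
Proof.
apply/setP=> A; rewrite !inE mem_map_of_bits ?filter_masks6 //.
rewrite mem_filter mem_masks size_bits eqxx andbT card_bits count_map.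
by congr (_ && (_ == k)); apply: eq_count => B; exact: subset_bits.
Qed.

Lemma outside_repeated_bits m (H : hypergraph m) s :
  all [pred b | size b == 6] s ->
  outside_repeated H [set:: map of_bits s]
    = [set:: map of_bits (outb (map bits H) s)].
Proof.
move=> s6; have o6: all [pred b | size b == 6] (outb (map bits H) s).
  by apply/allP=> b; rewrite mem_filter => /andP[_ /(allP s6)].
apply/setP=> A; rewrite !inE !mem_map_of_bits // mem_filter [RHS]andbC.
congr (_ && _); apply/forallP/allP => [noA b bR | noA t].
  have /implyP:= noA (of_bits b); rewrite subset_bits of_bitsK; last first.
    by apply/eqP; apply: (allP (filter_masks6 _) _ bR).
  apply; rewrite repeated_triangles_bits inE mem_map_of_bits ?filter_masks6 //.
  by rewrite of_bitsK //; apply/eqP; apply: (allP (filter_masks6 _) _ bR).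
apply/implyP; rewrite subset_bits => tR; apply: noA; move: tR.
by rewrite repeated_triangles_bits inE mem_map_of_bits ?filter_masks6.
Qed.

Lemma bits_hypergraph_of (f : nat -> nat -> bool) :
  map bits (hypergraph_of (\matrix_(i < 6, j < 6) f i j))
    = [seq [seq f i j | i <- iota 0 6] | j <- iota 0 6].
Proof.
rewrite -val_enum_ord -[RHS]map_comp -[LHS]map_comp; apply: eq_map => j /=.
by rewrite -[RHS]map_comp; apply: eq_map => i /=; rewrite inE mxE.
Qed.

Definition entry (c : label) (i j : nat) : bool :=
  nth 0 (nth [::] (rows c) i) j == 1.

Definition colsb (c : label) : seq bitseq :=
  [seq [seq entry c i j | i <- iota 0 6] | j <- iota 0 6].

Definition rowsb (c : label) : seq bitseq :=
  [seq [seq entry c i j | j <- iota 0 6] | i <- iota 0 6].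

Lemma bits_class c : map bits (class_hypergraph c) = colsb c.
Proof. exact: bits_hypergraph_of. Qed.

Lemma bits_class_tr c : map bits (hypergraph_of (mx_of c)^T) = rowsb c.
Proof.
apply: etrans (bits_hypergraph_of (fun i j => entry c j i)).
by congr (map bits (hypergraph_of _)); apply/matrixP=> i j; rewrite !mxE.
Qed.

(** * Enumeration of the semi-magic hypergraphs of rank 3 *)

Definition relabel (q : seq nat) (b : bitseq) : bitseq :=
  [seq nth false b k | k <- q].

Lemma relabelP (q : seq nat) : perm_eq q (iota 0 6) ->
  exists p : 'S_6, forall A : {set 'I_6}, bits (p @: A) = relabel q (bits A).
Proof.
move=> q6; have sq: size q = 6 by rewrite (perm_size q6).
have uq: uniq q by rewrite (perm_uniq q6) iota_uniq.
have lt_q (i : 'I_6) : nth 0 q i < 6.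
  have: nth 0 q i \in iota 0 6 by rewrite -(perm_mem q6) mem_nth ?sq.
  by rewrite mem_iota.
have f_inj : injective (fun i => Ordinal (lt_q i)).
  by move=> i j /(congr1 val) /= /eqP; rewrite nth_uniq ?sq // => /eqP /val_inj.
(* [relabel q] reads the entry at [nth 0 q i] into position [i], that is, takes the preimage under
   [i |-> nth 0 q i]; the image is therefore under the inverse permutation. *)
exists (perm f_inj)^-1%g => A.
apply: (@eq_from_nth _ false) => [|i]; rewrite size_bits ?size_map ?sq // => i6.
rewrite (nth_map 0) ?sq // -[i]/(nat_of_ord (Ordinal i6)) nth_bits.
rewrite -[X in nth _ _ X]/(nat_of_ord (Ordinal (lt_q (Ordinal i6)))) nth_bits.
by rewrite -{1}[Ordinal i6](permK (perm f_inj)) mem_imset ?permE //; exact: perm_inj.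
Qed.

Definition vertex_orders := permutations (iota 0 6).

(* Under [vm_compute], [&&] and [||] evaluate both sides, so that [has] always
   runs through the whole list; [find] stops at the first hit. *)
Definition any (T : Type) (a : pred T) (s : seq T) : bool := find a s < size s.

(* The first test is redundant; it discards most candidates cheaply. *)
Definition relabels (L L' : seq bitseq) (q : seq nat) : bool :=
  if any (fun b => relabel q b \notin L') L then false
  else perm_eq (map (relabel q) L) L'.

(** Soundness of the test. The list [L] stands between [H] and the test because the search delivers
    the edges of [H] only up to reordering. *)
Lemma relabels_hequiv m n (H : hypergraph m) (K : hypergraph n) L q :
  perm_eq (map bits H) L -> q \in vertex_orders ->
  relabels L (map bits K) q -> hequiv H K.
Proof.
move=> HL; rewrite mem_permutations => /relabelP[p pE].
rewrite /relabels; case: ifP => // _ LK.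
exists p; apply: (perm_map_inj bits_inj); rewrite -map_comp.
under eq_map => A do rewrite /= pE.
rewrite (map_comp (relabel q) bits).
by apply: perm_trans LK; apply: perm_map.
Qed.

Definition degb (L : seq bitseq) (i : nat) := count (fun b => nth false b i) L.

(** Pruning test: a vertex whose degree is not yet 3 must lie in some remaining candidate. Once no
    candidate is left, it says that every degree is exactly 3. *)
Definition viable (cands acc : seq bitseq) : bool :=
  all (fun i => (degb acc i == 3) || has (nth false ^~ i) cands) (iota 0 6).

Lemma subset_viable cands acc (L : seq bitseq) : {subset L <= cands} ->
  (forall i, i < 6 -> degb (L ++ acc) i = 3) -> viable cands acc.
Proof.
move=> sL d3; apply/allP => i; rewrite mem_iota => /andP[_ i6].
have [//|acc_lt3] := eqVneq; apply/hasP.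
have /hasP[b /sL] : has (nth false ^~ i) L; last by exists b.
rewrite has_count; have:= d3 i i6; rewrite /degb count_cat.
by case: count acc_lt3 => // /eqP.
Qed.

(* Tests [P] on the 3-regular multisets that extend [acc] by members of [cands],
   choosing the multiplicity of each candidate in turn. *)
Fixpoint search (P : pred (seq bitseq)) (cands acc : seq bitseq) : bool :=
  if ~~ viable cands acc then true
  else if cands is t :: ts then
    all (fun k => let acc' := nseq k t ++ acc in
      if all (fun i => degb acc' i <= 3) (iota 0 6) then search P ts acc'
      else true) (iota 0 4)
  else P acc.

(** Soundness of the search, by induction on the candidates: follow the branch that gives each
    candidate its multiplicity in [L]. The bound 3 on multiplicities matches the range
    [iota 0 4]. *)
Lemma searchP P cands acc (L : seq bitseq) :
  search P cands acc -> {subset L <= cands} ->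
  (forall t, count_mem t L <= 3) ->
  (forall i, i < 6 -> degb (L ++ acc) i = 3) ->
  exists2 L', perm_eq (L ++ acc) L' & P L'.
Proof.
elim: cands acc L => [|t ts IHts] acc L + sL cL d3;
  rewrite /search -/search (subset_viable sL d3).
  case: L sL {cL d3} => [|b L] sL; first by exists acc.
  by have:= sL b (mem_head _ _).
move=> /allP sk.
(* Split [L] into the [k] copies of [t], which join [acc], and the rest [L0], which uses only the
   candidates in [ts]. *)
pose k := count_mem t L; pose L0 := [seq b <- L | b != t].
have LE: perm_eq (L ++ acc) (L0 ++ (nseq k t ++ acc)).
  rewrite catA perm_cat2r -(perm_filterC (pred1 t) L) perm_catC perm_cat2l.
  by rewrite (all_pred1P _ _ (filter_all _ L)) size_filter.
have d3': forall i, i < 6 -> degb (L0 ++ (nseq k t ++ acc)) i = 3.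
  by move=> i i6; rewrite -(d3 i i6) /degb (seq.permP LE).
have [||||L' L'E PL'] := IHts (nseq k t ++ acc) L0; last first.
- by exists L' => //; apply: perm_trans LE L'E.
- exact: d3'.
- move=> b; apply: leq_trans (cL b); rewrite count_filter.
  by apply: sub_count => x /andP[].
- move=> b; rewrite mem_filter => /andP[/negPf bt /sL]; by rewrite inE bt.
(* The branch for [k] passes the degree test, since its edges form part of a family with all degrees
   3. *)
have:= sk k; rewrite mem_iota ltnS cL => /(_ isT); rewrite ifT //.
apply/allP => i; rewrite mem_iota => /andP[_ i6].
by rewrite -(d3' i i6) /degb [leqRHS]count_cat leq_addl.
Qed.

Definition triples := [seq b <- masks | count id b == 3].

Definition labels := [:: Ia; Ib; II; III; IV; V; VI].

Definition class_cols := map colsb labels.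

(* Only narrows down the classes that [classified] tries. *)
Definition profile (L : seq bitseq) : nat * nat :=
  let s := [seq count (fun b => nth false b i && nth false b j) L
              | i <- iota 0 6, j <- iota 0 6] in
  (count_mem 2 s, count_mem 3 s).

Definition classified (L : seq bitseq) : bool :=
  let pL := profile L in
  let cs := [seq L' <- class_cols | profile L' == pL] in
  any (fun q => any (fun L' => relabels L L' q) cs) vertex_orders.

Lemma all_classified : search classified triples [::].
Proof. by vm_compute. Qed.

Lemma class_colsP L : L \in class_cols -> exists c, L = colsb c.
Proof.
rewrite /class_cols /map !in_cons in_nil orbF.
by do ![case/predU1P => [->|]| move/eqP->]; eexists.
Qed.

Lemma semi_magic_class m (H : hypergraph m) :
  semi_magic 3 H -> exists c, hequiv H (class_hypergraph c).
Proof.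
move=> [H3 deg3].
have deg_bits i : i < 6 -> degb (map bits H) i = 3.
  move=> i6; apply: etrans (deg3 (Ordinal i6)); rewrite /degb count_map.
  apply: eq_count => e /=.
  by rewrite -[i]/(nat_of_ord (Ordinal i6)) nth_bits.
have [|t|i i6|L HL] := searchP (L := map bits H) all_classified.
- move=> b /mapP[e eH ->].
  by rewrite mem_filter mem_masks size_bits eqxx -card_bits H3.
(* An edge of [H] has a vertex, and every copy of the edge counts towards the degree 3 of that
   vertex. *)
- have [/mapP[e eH ->]|/count_memPn -> //] := boolP (t \in map bits H).
  have /card_gt0P[i ie] : 0 < #|e| by rewrite H3.
  rewrite count_mem_bits -[leqRHS](deg3 i); apply: sub_count => A /= /eqP ->.
  exact: ie.
- by rewrite cats0 deg_bits.
rewrite cats0 in HL.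
rewrite /classified /any -has_find => /hasP[q q6]; rewrite -has_find => /hasP[L'].
rewrite mem_filter => /andP[_ /class_colsP[c ->]] LL'.
by exists c; apply: relabels_hequiv HL q6 _; rewrite bits_class.
Qed.

(** * Invariance of the features *)

Lemma hequiv_sym m n (H : hypergraph m) (K : hypergraph n) :
  hequiv H K -> hequiv K H.
Proof.
case=> p HK; exists p^-1%g; rewrite perm_sym.
have -> : val H = [seq p^-1%g @: e | e : {set 'I_6} <-
                     [seq p @: e | e : {set 'I_6} <- H]].
  rewrite -map_comp map_id_in // => e _ /=.
  by rewrite -imset_comp (eq_imset _ (permK p)) imset_id.
exact: perm_map.
Qed.

Lemma hequiv_trans m n k (H : hypergraph m) (K : hypergraph n) (J : hypergraph k) :
  hequiv H K -> hequiv K J -> hequiv H J.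
Proof.
case=> p HK [q KJ]; exists (p * q)%g; apply: perm_trans KJ.
have -> : [seq (p * q)%g @: e | e : {set 'I_6} <- H]
    = [seq q @: e | e : {set 'I_6} <- [seq p @: e | e : {set 'I_6} <- H]].
  rewrite -map_comp; apply: eq_map => e /=; rewrite -imset_comp.
  by apply: eq_imset => i; rewrite /= permM.
exact: perm_map.
Qed.

Section Transport.

Variables (p : 'S_6) (m n : nat) (H : hypergraph m) (K : hypergraph n).
Hypothesis HK : perm_eq [seq p @: e | e : {set 'I_6} <- H] K.

Let im (A : {set 'I_6}) : {set 'I_6} := p @: A.

Let im_inj : injective im.
Proof. exact/imset_inj/perm_inj. Qed.

Let im_surj A : exists B, A = im B.
Proof.
by exists (p^-1%g @: A); rewrite /im -imset_comp (eq_imset _ (permKV p)) imset_id.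
Qed.

Let subset_im A B : (im A \subset im B) = (A \subset B).
Proof.
apply/idP/idP => [|/imsetS]; last exact.
by move/(imsetS p^-1%g); rewrite -!imset_comp !(eq_imset _ (permK p)) !imset_id.
Qed.

Let count_im (a : pred {set 'I_6}) : count a K = count (preim im a) H.
Proof. by rewrite -(seq.permP HK) count_map. Qed.

(** As every set is some [im A], it is enough to compare membership at such sets; each transport
    lemma for sets of sets goes through this. *)
Let eq_im (X Y : {set {set 'I_6}}) :
  (forall A, (im A \in Y) = (A \in X)) -> Y = im @: X.
Proof.
move=> XY; apply/setP=> A; have [B ->] := im_surj A.
by rewrite mem_imset // XY.
Qed.

Lemma count_mem_transport t : count_mem (im t) K = count_mem t H.
Proof. by rewrite count_im; apply: eq_count => A /=; rewrite inj_eq. Qed.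

Lemma repeated_transport : repeated_triangles K = im @: repeated_triangles H.
Proof. by apply: eq_im => A; rewrite !inE count_mem_transport. Qed.

Lemma multi_edges_transport k : multi_edges k K = im @: multi_edges k H.
Proof.
apply: eq_im => A; rewrite !inE card_imset; last exact: perm_inj.
by rewrite count_im; congr (_ && (_ == k)); apply: eq_count => B; exact: subset_im.
Qed.

Lemma outside_transport (X : {set {set 'I_6}}) :
  outside_repeated K (im @: X) = im @: outside_repeated H X.
Proof.
apply: eq_im => A; rewrite !inE mem_imset //; congr (_ && _).
rewrite repeated_transport.
apply/'forall_implyP/'forall_implyP => noA t.
  by move=> tR; rewrite -subset_im; apply: noA; rewrite imset_f.
by case/imsetP=> s sR ->; rewrite subset_im; exact: noA.
Qed.

Lemma disjoint_im (A B : {set 'I_6}) : [disjoint im A & im B] = [disjoint A & B].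
Proof.
rewrite -!setI_eq0 -imsetI ?imset_eq0 // => ? ? _ _; exact: perm_inj.
Qed.

Let im2 x y : im [set x; y] = [set p x; p y].
Proof. by rewrite /im imsetU1 imset_set1. Qed.

(** Each witness, vertex or set, is replaced by its image under [p]; images commute with the
    explicit finite sets of pairs and keep vertices distinct. *)
Lemma feature_transport c : feature c H -> feature c K.
Proof.
have uniq_p (s : seq 'I_6) : uniq s -> uniq (map p s).
  by rewrite map_inj_uniq //; exact: perm_inj.
case: c; rewrite /feature /double_edges /triple_edges repeated_transport
  !multi_edges_transport  ?outside_transport.
- case=> t [x [y [z [[-> ct] /uniq_p u dis -> ->]]]].
  exists (im t), (p x), (p y), (p z); split=> //;
    rewrite ?imset_set1 ?imset0 ?count_mem_transport //.
    by rewrite -disjoint_im /im !imsetU !imset_set1 in dis.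
  by rewrite !imsetU !imset_set1 !im2.
- case=> q [v [x [y [z [-> -> /uniq_p u -> dis]]]]].
  exists (im q), (p v), (p x), (p y), (p z); split=> //;
    rewrite ?imset_set1 ?imset0 //.
    by rewrite !imsetU !imset_set1 !im2.
  by rewrite -disjoint_im /im !imsetU !imset_set1 in dis.
- case=> v [x [y [w [x' [y' [-> -> /uniq_p u ->]]]]]].
  exists (p v), (p x), (p y), (p w), (p x'), (p y'); split=> //; rewrite ?imset0 //.
  by rewrite !imsetU !imset_set1 !im2.
- case=> t [t' [q [q' [[-> tt'] [ct ct'] [qt qt'] [-> qq'] ->]]]].
  exists (im t), (im t'), (im q), (im q').
  by rewrite !imsetU !imset_set1 imset0 !count_mem_transport !subset_im
    !(inj_eq im_inj).
- case=> u [v [w [x [y [z [-> -> /uniq_p un ->]]]]]].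
  exists (p u), (p v), (p w), (p x), (p y), (p z); split=> //; rewrite ?imset0 //.
  by rewrite !imsetU !imset_set1 !im2.
- case=> t [t' [[-> dis] [ct ct'] -> ->]].
  exists (im t), (im t').
  by rewrite !imsetU !imset_set1 imset0 !count_mem_transport disjoint_im.
- case=> u [v [w [x [y [z [-> -> /uniq_p un ->]]]]]].
  exists (p u), (p v), (p w), (p x), (p y), (p z); split=> //; rewrite ?imset0 //.
  by rewrite !imsetU !imset_set1 !im2.
Qed.

End Transport.

Lemma feature_hequiv c m n (H : hypergraph m) (K : hypergraph n) :
  hequiv H K -> feature c H -> feature c K.
Proof. by case=> p HK; exact: feature_transport HK c. Qed.

(** * Features of the seven classes *)

Definition mask_of (ks : seq nat) : bitseq := [seq k \in ks | k <- iota 0 6].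

Lemma bits_seq (s : seq 'I_6) (A : {set 'I_6}) :
  A =i s -> bits A = mask_of (map val s).
Proof.
move=> As; rewrite /mask_of -val_enum_ord -[RHS]map_comp; apply: eq_map => i /=.
by rewrite As mem_map //; exact: val_inj.
Qed.

Lemma bits2 (x y : 'I_6) : bits [set x; y] = mask_of [:: val x; val y].
Proof. by apply: (bits_seq (s := [:: x; y])) => i; rewrite !inE. Qed.

Lemma bits3 (x y z : 'I_6) : bits [set x; y; z] = mask_of [:: val x; val y; val z].
Proof. by apply: (bits_seq (s := [:: x; y; z])) => i; rewrite !inE orbA. Qed.

(** Reduces an equality with an explicitly listed set of sets to a comparison of lists up to order,
    which [vm_compute] decides. *)
Lemma set_of_bits (T : {set {set 'I_6}}) s t :
  T = [set:: t] -> perm_eq s (map bits t) -> [set:: map of_bits s] = T.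
Proof.
move=> -> /(perm_map of_bits) /perm_mem st; apply/setP=> A.
by rewrite !inE st (mapK bitsK).
Qed.

Ltac set_seq := rewrite ?set_cons ?set_nil ?setU0 ?setUA //.

Ltac class_sets :=
  rewrite ?/double_edges ?/triple_edges ?repeated_triangles_bits ?multi_edges_bits
    ?outside_repeated_bits ?filter_masks6 // ?bits_class;
  match goal with
  | |- _ = set0 => apply: (@set_of_bits _ _ [::])
  | |- _ = [set ?a] => apply: (@set_of_bits _ _ [:: a])
  | |- _ = [set ?a; ?b] => apply: (@set_of_bits _ _ [:: a; b])
  | |- _ = [set ?a; ?b; ?c] => apply: (@set_of_bits _ _ [:: a; b; c])
  | |- _ = [set ?a; ?b; ?c; ?d] => apply: (@set_of_bits _ _ [:: a; b; c; d])
  | |- _ = [set ?a; ?b; ?c; ?d; ?e; ?f] =>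
      apply: (@set_of_bits _ _ [:: a; b; c; d; e; f])
  end; [set_seq | rewrite ?map_cons ?bits3 ?bits2; by vm_compute].

Ltac class_count := rewrite -count_mem_bits bits_class ?bits3; by vm_compute.

Ltac ord_disjoint := let i := fresh "i" in apply/pred0P => i; rewrite !inE;
  by case: i => [[|[|[|[|[|[|]]]]]] ?].

Lemma feature_class c : feature c (class_hypergraph c).
Proof.
pose o0 : 'I_6 := @Ordinal 6 0 isT; pose o1 : 'I_6 := @Ordinal 6 1 isT.
pose o2 : 'I_6 := @Ordinal 6 2 isT; pose o3 : 'I_6 := @Ordinal 6 3 isT.
pose o4 : 'I_6 := @Ordinal 6 4 isT; pose o5 : 'I_6 := @Ordinal 6 5 isT.
case: c; rewrite /feature.
(* Witnesses are read off the columns, counted from 0. Here columns 0 and 1 are {0,1,5}, and each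
   pair in column 2, {2,3,4}, lies in one further column. *)
- exists [set o0; o1; o5], o2, o3, o4; split=> //;
    first (split; [class_sets | class_count]).
  + ord_disjoint.
  + class_sets.
  + class_sets.
(* The pair {0,5} lies in columns 0, 4 and 5; the other columns are {1,2,4}, {1,2,3} and {2,3,4},
   with double edges at vertex 2. *)
- exists [set o0; o5], o2, o1, o3, o4; split=> //.
  + class_sets.
  + class_sets.
  + class_sets.
  + ord_disjoint.
- exists o0, o1, o5, o3, o2, o4; split=> //; class_sets.
(* Besides the two repeated triples there are the columns {0,2,4} and {1,3,5}, which turn {2,4} and
   {1,5} into triple edges. *)
- exists [set o2; o3; o4], [set o0; o1; o5], [set o2; o4], [set o1; o5].
  split; [split | split | split | split |]; try class_sets; try class_count.
  + by rewrite -(inj_eq bits_inj) !bits3.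
  + by rewrite subUset !sub1set !inE.
  + by rewrite subUset !sub1set !inE.
  + by rewrite -(inj_eq bits_inj) !bits2.
- exists o0, o1, o2, o3, o4, o5; split=> //; class_sets.
- exists [set o3; o4; o5], [set o0; o1; o2].
  split; [split | split | |]; try class_sets; try class_count; ord_disjoint.
- exists o0, o1, o2, o3, o4, o5; split=> //; class_sets.
Qed.

(* [r], [t] and [d] stand for the numbers of repeated triangles, triple edges
   and double edges. *)
Definition shape (c : label) (r t d : nat) (L : seq bitseq) : bool :=
  match c with
  | Ia => r == 1
  | Ib => (r == 0) && (t == 1)
  | II => [&& r == 0, t == 0 & d == 4]
  | III => (r == 2) && has (fun b => count_mem b L == 2) L
  | IV => [&& r == 0, t == 0 & d == 6]
  | V => has (fun b => count_mem b L == 3) L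
  | VI => [&& r == 0, t == 0 & d == 3]
  end.

(** Checked on all 49 pairs of classes. [III] and [V] both have two repeated triangles and differ in
    their multiplicity; [II], [IV] and [VI] differ in the number of double edges. *)
Lemma shape_class c c' : let L := colsb c' in
  shape c (size (repb L)) (size (multib 3 L)) (size (multib 2 L)) L -> c = c'.
Proof. by case: c; case: c' => //; vm_compute. Qed.

(** [of_bits] is injective on vectors of length 6, so cardinalities of feature sets become lengths
    of computed lists. *)
Lemma card_set_of_bits (a : pred bitseq) :
  #|[set:: map of_bits (filter a masks)]| = size (filter a masks).
Proof.
rewrite cardsE (card_uniqP _) ?size_map // map_inj_in_uniq ?filter_uniq //.
by move=> b b'; rewrite !mem_filter !mem_masks
  => /andP[_ /eqP b6] /andP[_ /eqP b6'] /(congr1 bits); rewrite !of_bitsK.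
Qed.

Lemma card_repeated m (H : hypergraph m) :
  size (repb (map bits H)) = #|repeated_triangles H|.
Proof. by rewrite repeated_triangles_bits card_set_of_bits. Qed.

Lemma card_multi k m (H : hypergraph m) :
  size (multib k (map bits H)) = #|multi_edges k H|.
Proof. by rewrite multi_edges_bits card_set_of_bits. Qed.

Lemma card_set_seq (T : finType) (s : seq T) : uniq s -> #|[set:: s]| = size s.
Proof. by move=> us; rewrite cardsE (card_uniqP us). Qed.

Lemma has_count_mem k m (H : hypergraph m) t :
  count_mem t H = k.+1 ->
  has (fun b => count_mem b (map bits H) == k.+1) (map bits H).
Proof.
move=> tk; apply/hasP; exists (bits t); last by rewrite count_mem_bits tk.
by apply: map_f; rewrite -has_pred1 has_count tk.
Qed.

(* Distinct vertices may be taken to be [0, 1, ...], so that comparing the pairs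
   they form becomes a computation on the indices. *)
Lemma card_pairs (T : finType) x0 (s : seq T) (ks : seq (nat * nat)) :
  uniq s -> all [pred k | (k.1 < size s) && (k.2 < size s)] ks ->
  uniq [seq [seq (k.1 == i) || (k.2 == i) | i <- iota 0 (size s)] | k <- ks] ->
  #|[set:: [seq [set nth x0 s k.1; nth x0 s k.2] | k <- ks]]| = size ks.
Proof.
move=> us ks_s; pose f (A : {set T}) :=
  [seq nth x0 s i \in A | i <- iota 0 (size s)].
(* The vectors in the last hypothesis are the values of [f] on the pairs, so their distinctness
   implies that of the pairs. *)
rewrite -[X in uniq X -> _](_ :
  map f [seq [set nth x0 s k.1; nth x0 s k.2] | k <- ks] = _).
  by move/map_uniq => uk; rewrite cardsE (card_uniqP uk) size_map.
rewrite -map_comp; apply/eq_in_map => k /(allP ks_s) /andP[k1 k2].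
apply/eq_in_map => i; rewrite mem_iota => /andP[_ is_].
by rewrite !inE !nth_uniq // ![i == _]eq_sym.
Qed.

Lemma feature_shape c m (H : hypergraph m) : feature c H ->
  shape c #|repeated_triangles H| #|triple_edges H| #|double_edges H| (map bits H).
Proof.
case: c; rewrite /feature /shape.
- by case=> t [x [y [z [[-> _] _ _ _ _]]]]; rewrite cards1.
- by case=> p [v [x [y [z [-> -> _ _ _]]]]]; rewrite cards0 cards1.
- case=> v [x [y [w [x' [y' [-> -> un ->]]]]]]; rewrite cards0 /=.
  (* The indices refer to positions in the list [v, x, y, w, x', y'] of distinct vertices. *)
  by have := card_pairs (ks := [:: (0, 1); (0, 2); (3, 4); (3, 5)]) v un isT isT;
    rewrite /= !set_cons set_nil setU0 !setUA => ->.
- case=> t [t' [p [p' [[-> tt'] [ct _] _ _ _]]]].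
  by rewrite cards2 tt' (has_count_mem ct).
- case=> u [v [w [x [y [z [-> -> un ->]]]]]]; rewrite cards0 /=.
  by have := card_pairs (ks := [:: (0, 1); (1, 2); (2, 3); (3, 4); (4, 5); (5, 0)])
                        u un isT isT;
    rewrite /= !set_cons set_nil setU0 !setUA => ->.
- by case=> t [t' [_ [ct _] _ _]]; rewrite (has_count_mem ct).
- case=> u [v [w [x [y [z [-> -> un ->]]]]]]; rewrite cards0 /=.
  by have := card_pairs (ks := [:: (0, 1); (2, 3); (4, 5)]) u un isT isT;
    rewrite /= !set_cons set_nil setU0 !setUA => ->.
Qed.

Lemma feature_class_inj c c' : feature c (class_hypergraph c') -> c = c'.
Proof.
move/feature_shape; rewrite /triple_edges /double_edges.
by rewrite -card_repeated -!card_multi bits_class => /shape_class.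
Qed.

(** * Orbits *)

Lemma class_inj c c' :
  hequiv (class_hypergraph c) (class_hypergraph c') -> c = c'.
Proof.
by move=> cc'; apply/feature_class_inj/(feature_hequiv cc')/feature_class.
Qed.

Lemma shuffleE s t (M : 'M[bool]_6) i j : shuffle s t M i j = M (s i) (t j).
Proof.
rewrite /shuffle invmx_perm -row_permE.
by rewrite -col_permE !mxE.
Qed.

(** A bijection of the vertices permutes the rows, and equality of edge multisets leaves a free
    permutation of the columns. *)
Lemma hequiv_shuffle (M N : 'M[bool]_6) :
  hequiv (hypergraph_of M) (hypergraph_of N) <-> exists s t, N = shuffle s t M.
Proof.
split=> [[p]|[s [t ->]]].
  (* Row [i] of a shuffle is row [s i] of [M], so the vertex bijection [p] enters as its inverse;
     [t] is the reordering of the edges. *)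
  rewrite perm_sym => /tuple_permP[t NM]; exists (p^-1)%g, t; apply/matrixP=> i j.
  have : tnth (hypergraph_of N) j = p @: tnth (hypergraph_of M) (t j).
    by rewrite (val_inj NM) tnth_mktuple tnth_map.
  rewrite !tnth_mktuple shuffleE => /setP/(_ i).
  rewrite inE => ->; rewrite -{1}[i](permKV p) mem_imset ?inE //.
  exact: perm_inj.
exists s^-1%g; rewrite perm_sym; apply/tuple_permP; exists t; congr val.
apply: eq_from_tnth => j; rewrite !tnth_mktuple tnth_map tnth_mktuple.
apply/setP=> i; rewrite inE shuffleE -{2}[i](permK s).
by rewrite mem_imset ?inE //; exact: perm_inj.
Qed.

Lemma mem_G_orbit (M N : 'M[bool]_6) :
  N \in G_orbit M <->
  hequiv (hypergraph_of M) (hypergraph_of N) \/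
  hequiv (hypergraph_of M^T) (hypergraph_of N).
Proof.
split=> [/orbitP[g /GP[s [t gE]] <-]|].
  by case: gE => /= gE; rewrite /aperm gE; [left|right];
    apply/hequiv_shuffle; exists s, t.
case=> /hequiv_shuffle[s [t ->]]; apply/orbitP.
  exists (perm (@shuffle_inj s t)); last by rewrite /= /aperm permE.
  by apply/GP; exists s, t; left=> ?; rewrite permE.
exists (perm (@shuffleT_inj s t)); last by rewrite /= /aperm permE.
by apply/GP; exists s, t; right=> ?; rewrite permE.
Qed.

(** * Transposition and dual classes *)

Definition dual (c : label) : label :=
  match c with Ia => Ib | Ib => Ia | _ => c end.

(** The edges of the transposed hypergraph are the rows of the matrix; a suitable relabelling is
    found by computation. *)
Lemma class_tr c :
  hequiv (hypergraph_of (mx_of c)^T) (class_hypergraph (dual c)).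
Proof.
have /hasP[q q6 qc] : has (relabels (rowsb c) (colsb (dual c))) vertex_orders.
  by case: c; vm_compute.
by apply: relabels_hequiv q6 _; rewrite ?bits_class // bits_class_tr.
Qed.

(** Transposing a shuffle swaps its two permutations, so the class of the transpose depends only on
    the class of [M]. *)
Lemma hequiv_class_tr M c : hequiv (hypergraph_of M) (class_hypergraph c) ->
  hequiv (hypergraph_of M^T) (class_hypergraph (dual c)).
Proof.
move/hequiv_sym/hequiv_shuffle=> [s [t ->]]; apply: hequiv_trans (class_tr c).
by apply/hequiv_sym/hequiv_shuffle; exists t, s; rewrite shuffle_tr.
Qed.

Lemma mem_class_orbit M c : M \in G_orbit (mx_of c) <->
  hequiv (hypergraph_of M) (class_hypergraph c) \/
  hequiv (hypergraph_of M) (class_hypergraph (dual c)).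
Proof.
split=> [/mem_G_orbit[]cM|[]Mc];
  [left|right|apply/mem_G_orbit; left|apply/mem_G_orbit; right].
- exact: hequiv_sym.
- by apply: hequiv_trans (class_tr c); exact: hequiv_sym.
- exact: hequiv_sym.
- by apply: hequiv_trans (class_tr c) _; exact: hequiv_sym.
Qed.

(** * Orbits of the rank-3 matrices *)

Lemma semi_magic_hypergraph_of r M :
  M \in of_rank r -> semi_magic r (hypergraph_of M).
Proof.
rewrite inE => /andP[/forallP rowM /forallP colM]; split.
  move=> e /tnthP[j ->]; rewrite tnth_mktuple -(eqP (colM j)).
  rewrite -sum1dep_card big_mkcond.
  by apply: eq_bigr => i _; case: (M i j).
move=> i; rewrite -(eqP (rowM i)) count_map -sum1_count big_enum_cond big_mkcond.
by apply: eq_bigr => j _ /=; rewrite inE; case: (M i j).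
Qed.

Lemma of_rank_class c : mx_of c \in of_rank 3.
Proof.
rewrite inE; apply/andP; split; apply/forallP=> i; under eq_bigr do rewrite mxE.
  case: c; case: i => [[|[|[|[|[|[|]]]]]] ?] //; by rewrite !big_ord_recl big_ord0.
case: c; case: i => [[|[|[|[|[|[|]]]]]] ?] //; by rewrite !big_ord_recl big_ord0.
Qed.

Lemma of_rank_hequiv M : M \in of_rank 3 ->
  exists c, hequiv (hypergraph_of M) (class_hypergraph c).
Proof. by move/semi_magic_hypergraph_of/semi_magic_class. Qed.

Lemma G_orbit_eq M N : M \in G_orbit N -> G_orbit M = G_orbit N.
Proof. by move=> MN; apply/orbit_eqP. Qed.

Lemma mem_G_orbit_class c c' :
  mx_of c \in G_orbit (mx_of c') -> c = c' \/ c = dual c'.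
Proof. by case/mem_class_orbit=> /class_inj; [left|right]. Qed.

Lemma rank3_orbits :
  [set G_orbit M | M in of_rank 3]
    = [set:: [seq G_orbit (mx_of c) | c <- [:: Ia; II; III; IV; V; VI]]].
Proof.
apply/setP=> X; apply/imsetP/idP => [[M /of_rank_hequiv[c Mc] ->]|].
  (* [Ib] is the dual of [Ia], so matrices of either class lie in the orbit of [Ia], and [Ib] can be
     avoided as a representative. *)
  have [c' -> cc'] : exists2 c', G_orbit M = G_orbit (mx_of c') & c' <> Ib.
    case: c Mc => Mc;
      [exists Ia|exists Ia|exists II|exists III|exists IV|exists V|exists VI] => //;
      by apply/G_orbit_eq/mem_class_orbit; auto.
  by case: c' cc' => // _; rewrite !inE eqxx ?orbT.
rewrite !inE => XE; have [c ->] : exists c, X = G_orbit (mx_of c).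
  by move: XE; do ![case/predU1P => [->|]| move/eqP->]; eexists.
by exists (mx_of c); rewrite ?of_rank_class.
Qed.

Lemma card_rank3_orbits : #|[set G_orbit M | M in of_rank 3]| = 6.
Proof.
(* Equal orbits would make one class equal or dual to the other. *)
have neq c c' : c <> c' -> c <> dual c' ->
  (G_orbit (mx_of c) == G_orbit (mx_of c')) = false.
  move=> cc' cd; apply/eqP=> oE; have : mx_of c \in G_orbit (mx_of c').
    by rewrite -oE orbit_refl.
  by case/mem_G_orbit_class.
by rewrite rank3_orbits card_set_seq //= !inE !neq.
Qed.

Theorem theorem11p1 :
  (forall c : label, mx_of c \in of_rank 3) /\
  (forall (m : nat) (H : hypergraph m), semi_magic 3 H ->
     exists! c : label, hequiv H (class_hypergraph c)) /\
  ([set G_orbit M | M in of_rank 3]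
     = [set G_orbit (mx_of Ia); G_orbit (mx_of II); G_orbit (mx_of III);
            G_orbit (mx_of IV); G_orbit (mx_of V); G_orbit (mx_of VI)]
   /\ #|[set G_orbit M | M in of_rank 3]| = 6
   /\ mx_of Ib \in G_orbit (mx_of Ia)) /\
  (forall M : 'M[bool]_6, M \in of_rank 3 ->
     (~ hequiv (hypergraph_of M) (hypergraph_of M^T)
        <-> M \in G_orbit (mx_of Ia)) /\
     (M \in G_orbit (mx_of Ia) ->
        (hequiv (hypergraph_of M) (class_hypergraph Ia) /\
         hequiv (hypergraph_of M^T) (class_hypergraph Ib)) \/
        (hequiv (hypergraph_of M) (class_hypergraph Ib) /\
         hequiv (hypergraph_of M^T) (class_hypergraph Ia))) /\
     (forall c : label, c <> Ia -> c <> Ib -> M \in G_orbit (mx_of c) ->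
        hequiv (hypergraph_of M) (hypergraph_of M^T))) /\
  (forall (m : nat) (H : hypergraph m), semi_magic 3 H ->
     forall c : label, hequiv H (class_hypergraph c) <-> feature c H).
Proof.
split; first exact: of_rank_class.
split.
  move=> m H /semi_magic_class[c Hc]; exists c; split=> // c' Hc'.
  by apply/class_inj/hequiv_trans/Hc'/hequiv_sym.
split.
  split; first by rewrite rank3_orbits /= !set_cons set_nil setU0 !setUA.
  split; first exact: card_rank3_orbits.
  by apply/mem_G_orbit; right; exact: class_tr Ia.
split; last first.
  move=> m H /semi_magic_class[c' Hc'] c; split=> [/hequiv_sym Hc|cH].
    exact: feature_hequiv Hc (feature_class c).
  (* Carried over to the representative of the class [c'] of [H], the feature of [c] forces
     [c = c']. *)
  by have /feature_class_inj-> := feature_hequiv Hc' cH.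
move=> M /of_rank_hequiv[c Mc]; have Mtc := hequiv_class_tr Mc.
have selfdual : c = dual c -> hequiv (hypergraph_of M) (hypergraph_of M^T).
  by move=> cE; apply: hequiv_trans Mc _; rewrite cE; exact: hequiv_sym.
have Muniq c' : hequiv (hypergraph_of M) (class_hypergraph c') -> c = c'.
  by move=> Mc'; apply/class_inj/hequiv_trans/Mc'/hequiv_sym.
split; [split|split].
- move=> nMMt; apply/mem_class_orbit.
  case: c Mc selfdual {Mtc Muniq} => Mc sd; [left | right | | | | |] => //;
    by case: nMMt; exact: sd.
- move=> MIa MMt.
  (* Equivalence of the pair would make [c] self-dual, which fails for [Ia] and [Ib], the only
     classes in this orbit. *)
  have /class_inj : hequiv (class_hypergraph c) (class_hypergraph (dual c)).
    exact: hequiv_trans (hequiv_sym Mc) (hequiv_trans MMt Mtc).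
  by case/mem_class_orbit: MIa => /Muniq ->.
- by case/mem_class_orbit=> /Muniq cE; move: Mc Mtc; rewrite cE; [left|right].
- move=> c' nIa nIb /mem_class_orbit Mc'; apply: selfdual.
  by case: Mc' => /Muniq ->; case: c' nIa nIb.
Qed.
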